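(* For all $n\geq 1$ and $\sigma\in\{123,132,231\}$, the number of desarrangements of length $n$ avoiding both $213$ and $\sigma$ is $d_n(213,\sigma)=J_{n-1}$, the $(n-1)$st Jacobsthal number.
   Context: Permutations are in one-line notation. An index $i\in[n-1]$ is a descent of $\pi\in\mathfrak{S}_n$ if $\pi_i>\pi_{i+1}$; $i\in[n]$ is an ascent if it is not a descent (so $n$ is always an ascent). A desarrangement is a permutation whose first ascent is even. $d_n(\Pi)$ is the number of desarrangements in $\mathfrak{S}_n$ avoiding every pattern in $\Pi$ ($\pi$ avoids $\sigma$ if no subsequence of $\pi$ has the same relative order as $\sigma$). The Jacobsthal numbers are defined by $J_0=0$, $J_1=1$, $J_n=J_{n-1}+2J_{n-2}$ for $n\ge2$. *)

(* Defs.v *)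
From mathcomp Require Import all_boot all_fingroup.

Set Implicit Arguments.
Unset Strict Implicit.
Unset Printing Implicit Defensive.

(* One-line notation: 'S_n acts on {0, ..., n-1}, so values are shifted to
   {1, ..., n}. *)
Definition one_line (n : nat) (p : 'S_n) : seq nat :=
  [seq (p i).+1 | i <- enum 'I_n].

(* Positions are numbered from 1, so the entry w_i is [nth 0 w i.-1]. *)
Definition descent (w : seq nat) (i : nat) : bool :=
  (0 < i < size w) && (nth 0 w i.-1 > nth 0 w i).

Definition ascent (w : seq nat) (i : nat) : bool :=
  (0 < i <= size w) && ~~ descent w i.

(* The default 0 is reached only by the empty word: otherwise [size w] is an
   ascent. *)
Definition first_ascent (w : seq nat) : nat :=
  head 0 [seq i <- iota 1 (size w) | ascent w i].

Definition desarrangement (n : nat) (p : 'S_n) : bool :=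
  ~~ odd (first_ascent (one_line p)).

Definition same_order (u v : seq nat) : bool :=
  (size u == size v) &&
  [forall i : 'I_(size u), forall j : 'I_(size u),
     (nth 0 u i < nth 0 u j) == (nth 0 v i < nth 0 v j)].

(* The subsequences of w are the [mask m w]. *)
Definition contains (w s : seq nat) : bool :=
  [exists m : (size w).-tuple bool, same_order (mask m w) s].

Definition avoids (n : nat) (p : 'S_n) (s : seq nat) : bool :=
  ~~ contains (one_line p) s.

Definition num_desarr (n : nat) (Pi : seq (seq nat)) : nat :=
  #|[set p : 'S_n | desarrangement p && all (avoids p) Pi]|.

Fixpoint jacobsthal (n : nat) : nat :=
  match n with
  | 0 => 0
  | 1 => 1
  | (m.+1 as k).+1 => jacobsthal k + 2 * jacobsthal m
  end.

(* Main.v *)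
Require Import Defs.
From mathcomp Require Import all_boot all_fingroup.
From mathcomp Require Import zify.

(** Write [a_n] for the number of avoiders of 213 and sigma, and [d_n] for the
    number of desarrangements among them. In a 213-avoider the letters before
    the maximum increase, so its first ascent is 1 unless it starts with its
    maximum. Removing a maximum in front decreases the first ascent by one, and
    no pattern starts with its largest letter, so a maximum in front is never
    part of an occurrence: hence [d_(n+1) = a_n - d_n]. Since
    [J_n + J_(n+1) = 2 ^ n], it remains to see that [a_(n+1) = 2 a_n] for
    [n >= 1]. Apart from the maximum in front, each avoider of length [n] can be
    extended in exactly one way:
    - for 123, by the maximum in second position, as the letters before the
      maximum must be both increasing and decreasing;
    - for 132, by the maximum just after the previous maximum, as the letters
      before the maximum increase and exceed all letters after it;
    - for 231, by the minimum in front, as a first letter that is neither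
      minimal nor maximal completes a 213 or a 231. *)

Set Implicit Arguments.
Unset Strict Implicit.
Unset Printing Implicit Defensive.

Section Pairwise.

Variables (T : eqType) (r : rel T).

Lemma pairwise_subseqP (w : seq T) :
  reflect (forall x y, subseq [:: x; y] w -> r x y) (pairwise r w).
Proof.
apply: (iffP idP) => [rw x y /subseq_pairwise/(_ rw) | ].
  by rewrite pairwise2.
elim: w => //= a w IHw rw; apply/andP; split.
  by apply/allP => y yw; apply: rw; rewrite eqxx sub1seq.
by apply: IHw => x y xyw; apply: rw; case: eqP => // _; apply: cons_subseq xyw.
Qed.

Lemma pairwise_in2 (w : seq T) : {in w &, forall x y, r x y} -> pairwise r w.
Proof.
move=> rw; apply/pairwise_subseqP => x y /mem_subseq xyw.
by apply: rw; apply: xyw; rewrite !inE eqxx ?orbT.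
Qed.

End Pairwise.

Section Triplewise.

Variables (T : Type) (r : T -> T -> T -> bool).

Fixpoint triplewise (w : seq T) : bool :=
  if w is x :: w then pairwise (r x) w && triplewise w else true.

Lemma triplewise_cat_cons (p : seq T) (m : T) (q : seq T) :
  triplewise (p ++ m :: q) =
  [&& triplewise (p ++ q), pairwise (fun x y => r x y m) p,
      allrel (r^~ m) p q & pairwise (r m) q].
Proof.
elim: p => [|a p IHp] /=; first by rewrite andbC.
rewrite IHp !pairwise_cat allrel_consr allrel_consl pairwise_cons /=.
by lia.
Qed.

End Triplewise.

Lemma triplewise_map (T U : Type) (f : T -> U) (r : U -> U -> U -> bool)
    (w : seq T) :
  triplewise r (map f w) = triplewise (fun x y z => r (f x) (f y) (f z)) w.
Proof. by elim: w => //= x w ->; rewrite pairwise_map. Qed.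

Lemma triplewise_subseqP (T : eqType) (r : T -> T -> T -> bool) (w : seq T) :
  reflect (forall x y z, subseq [:: x; y; z] w -> r x y z) (triplewise r w).
Proof.
elim: w => [|a w IHw] /=; first by left.
apply: (iffP andP) => [[/pairwise_subseqP ra /IHw rw] x y z | raw].
  by case: eqP => [-> /ra | _ /rw].
split; first by apply/pairwise_subseqP => y z yz; apply: raw; rewrite eqxx.
apply/IHw => x y z xyz; apply: raw; case: eqP => // _.
exact: cons_subseq xyz.
Qed.

Lemma index_pivot (T : eqType) (x y : T) (p q : seq T) :
  uniq (p ++ y :: q) -> (size p == index x (p ++ y :: q)) = (x == y).
Proof.
rewrite cat_uniq index_cat => /and3P[_ /norP[/= yp _] _].
have [-> | _] := eqVneq x y; first by rewrite (negbTE yp) addn0 eqxx.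
case: ifP => [xp | _]; first by rewrite gtn_eqF // index_mem.
by rewrite -{1}[size p]addn0 eqn_add2l.
Qed.

Definition insert_at (T : Type) (i : nat) (x : T) (w : seq T) : seq T :=
  take i w ++ x :: drop i w.

Lemma insert_at_cat (T : Type) (x : T) (p q : seq T) :
  insert_at (size p) x (p ++ q) = p ++ x :: q.
Proof. by rewrite /insert_at take_size_cat ?drop_size_cat. Qed.

Lemma filter_insert_at (T : eqType) (i : nat) (x : T) (w : seq T) :
  x \notin w -> filter (predC1 x) (insert_at i x w) = w.
Proof.
move=> xw; rewrite filter_cat /= eqxx /= -filter_cat cat_take_drop.
by apply/all_filterP/allP => y yw; apply: contraNneq xw => <-.
Qed.

Implicit Types (a b c i m n x y z : nat) (p q s t u v w : seq nat).
Implicit Type Pi : seq (seq nat).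

Lemma containsP w s :
  reflect (exists2 u, subseq u w & same_order u s) (contains w s).
Proof.
apply: (iffP existsP) => [[m us] | [u /subseqP[m sz_m ->] us]].
  by exists (mask m w); rewrite ?mask_subseq.
have sz : size m == size w by rewrite sz_m.
by exists (Tuple sz).
Qed.

Lemma same_orderP u v :
  reflect (size u = size v /\ {in gtn (size u) &, forall i j,
             (nth 0 u i < nth 0 u j) = (nth 0 v i < nth 0 v j)})
          (same_order u v).
Proof.
apply: (iffP andP) => [[/eqP sz /forallP uv] | [-> uv]].
  split=> // i j i_lt j_lt.
  by have /eqP := forallP (uv (Ordinal i_lt)) (Ordinal j_lt).
by split=> //; apply/forallP => i; apply/forallP => j; rewrite uv ?inE.
Qed.

Lemma same_order3 x y z a b c :
  same_order [:: x; y; z] [:: a; b; c] =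
  [&& (x < y) == (a < b), (x < z) == (a < c), (y < x) == (b < a),
      (y < z) == (b < c), (z < x) == (c < a) & (z < y) == (c < b)].
Proof.
apply/same_orderP/idP => [[_ xyz] | ]; last first.
  case/and5P=> /eqP ? /eqP ? /eqP ? /eqP ? /andP[/eqP ? /eqP ?]; split=> // i j.
  by case: i j => [|[|[|i]]] [|[|[|j]]] //= _ _; rewrite !ltnn.
apply/and5P; split; last (apply/andP; split); apply/eqP.
- exact: (xyz 0 1).
- exact: (xyz 0 2).
- exact: (xyz 1 0).
- exact: (xyz 1 2).
- exact: (xyz 2 0).
- exact: (xyz 2 1).
Qed.

Lemma contains_size w s : contains w s -> size s <= size w.
Proof. by case/containsP => u /size_subseq + /same_orderP[<- _]. Qed.

Definition head_below_max s : bool := has (ltn (head 0 s)) s.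

Lemma contains_cons_max m w s :
  all (gtn m) w -> head_below_max s -> contains (m :: w) s = contains w s.
Proof.
rewrite /head_below_max => /allP w_lt; case: s => //= a t; rewrite ltnn /=.
case/(has_nthP 0) => i i_lt /= a_lt.
apply/containsP/containsP => -[u uw us]; last first.
  by exists u => //; apply: subseq_trans uw (subseq_cons _ _).
exists u => //; case: u uw us => [|b u] /=; first by rewrite sub0seq.
case: eqP => // -> uw /same_orderP[[sz_u] us].
have /= := us 0 i.+1; rewrite a_lt !inE ltnS sz_u => /(_ isT i_lt).
have /w_lt /= : nth 0 u i \in w by apply/(mem_subseq uw)/mem_nth; rewrite sz_u.
by lia.
Qed.

Lemma avoids_triplewise a b c (r : nat -> nat -> nat -> bool) :
  (forall x y z, same_order [:: x; y; z] [:: a; b; c] = ~~ r x y z) ->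
  forall w, ~~ contains w [:: a; b; c] = triplewise r w.
Proof.
move=> abcE w; apply/idP/triplewise_subseqP => [av x y z xyz | rw].
  apply: contraNT av => nr; apply/containsP.
  by exists [:: x; y; z]; rewrite ?abcE.
apply/containsP => -[u]; case: u => [|x [|y [|z [|t u]]]] // /rw.
by rewrite abcE => ->.
Qed.

Lemma avoids213 w :
  ~~ contains w [:: 2; 1; 3] = triplewise (fun x y z => ~~ (y < x < z)) w.
Proof. by apply: avoids_triplewise => x y z; rewrite same_order3 /=; lia. Qed.

Lemma avoids123 w :
  ~~ contains w [:: 1; 2; 3] = triplewise (fun x y z => ~~ (x < y < z)) w.
Proof. by apply: avoids_triplewise => x y z; rewrite same_order3 /=; lia. Qed.

Lemma avoids132 w :
  ~~ contains w [:: 1; 3; 2] = triplewise (fun x y z => ~~ (x < z < y)) w.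
Proof. by apply: avoids_triplewise => x y z; rewrite same_order3 /=; lia. Qed.

Lemma avoids231 w :
  ~~ contains w [:: 2; 3; 1] = triplewise (fun x y z => ~~ (z < x < y)) w.
Proof. by apply: avoids_triplewise => x y z; rewrite same_order3 /=; lia. Qed.

Section InsertMax.

Variables (p q : seq nat) (m : nat).
Hypothesis m_max : all (gtn m) (p ++ q).

Let p_lt : {in p, forall x, x < m}.
Proof. by move=> x xp; apply: (allP m_max); rewrite mem_cat xp. Qed.

Let q_lt : {in q, forall x, x < m}.
Proof. by move=> x xq; apply: (allP m_max); rewrite mem_cat xq orbT. Qed.

Lemma avoids213_insert_max :
  ~~ contains (p ++ m :: q) [:: 2; 1; 3] =
  ~~ contains (p ++ q) [:: 2; 1; 3] && pairwise leq p.
Proof.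
rewrite !avoids213 triplewise_cat_cons.
have -> : allrel (fun x z => ~~ (m < x < z)) p q.
  by apply/allrelP => x z /p_lt; lia.
have -> : pairwise (fun y z => ~~ (y < m < z)) q.
  by apply: pairwise_in2 => y z _ /q_lt; lia.
congr andb; rewrite !andbT.
by apply: eq_in_pairwise (allss p) => x y /p_lt x_lt _; lia.
Qed.

Lemma avoids123_insert_max :
  ~~ contains (p ++ m :: q) [:: 1; 2; 3] =
  ~~ contains (p ++ q) [:: 1; 2; 3] && pairwise geq p.
Proof.
rewrite !avoids123 triplewise_cat_cons.
have -> : allrel (fun x z => ~~ (x < m < z)) p q.
  by apply/allrelP => x z _ /q_lt; lia.
have -> : pairwise (fun y z => ~~ (m < y < z)) q.
  by apply: pairwise_in2 => y z /q_lt; lia.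
congr andb; rewrite !andbT.
by apply: eq_in_pairwise (allss p) => x y _ /p_lt y_lt /=; lia.
Qed.

Lemma avoids132_insert_max :
  ~~ contains (p ++ m :: q) [:: 1; 3; 2] =
  ~~ contains (p ++ q) [:: 1; 3; 2] && allrel geq p q.
Proof.
rewrite !avoids132 triplewise_cat_cons.
have -> : pairwise (fun x y => ~~ (x < m < y)) p.
  by apply: pairwise_in2 => x y _ /p_lt; lia.
have -> : pairwise (fun y z => ~~ (m < z < y)) q.
  by apply: pairwise_in2 => y z _ /q_lt; lia.
congr andb; rewrite andbT.
by apply: eq_in_allrel (allss p) (allss q) => x z _ /q_lt z_lt /=; lia.
Qed.

End InsertMax.

Definition cons_min (w : seq nat) : seq nat := 1 :: map succn w.

Lemma avoids213_cons_min w :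
  ~~ contains (cons_min w) [:: 2; 1; 3] = ~~ contains w [:: 2; 1; 3].
Proof.
rewrite !avoids213 /= triplewise_map pairwise_map (_ : pairwise _ w) //.
by apply: pairwise_in2.
Qed.

Lemma avoids231_cons_min w :
  ~~ contains (cons_min w) [:: 2; 3; 1] = ~~ contains w [:: 2; 3; 1].
Proof.
rewrite !avoids231 /= triplewise_map pairwise_map (_ : pairwise _ w) //.
by apply: pairwise_in2.
Qed.

Lemma avoids213_231_head_extremal a w : a \notin w ->
  ~~ contains (a :: w) [:: 2; 1; 3] -> ~~ contains (a :: w) [:: 2; 3; 1] ->
  all (gtn a) w || all (ltn a) w.
Proof.
case: w => // y w; rewrite inE negb_or => /andP[ay aw].
rewrite avoids213 avoids231 /= => /andP[/andP[/allP a213 _] _].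
case/andP => /andP[/allP a231 _] _.
have z_neq z : z \in w -> z != a by move=> zw; apply: contraNneq aw => <-.
case: ltngtP ay => // ya _ /=.
- rewrite orbF; apply/allP => z zw /=.
  by have := z_neq z zw; have := a213 z zw; lia.
- apply/allP => z zw /=.
  by have := z_neq z zw; have := a231 z zw; lia.
Qed.

Lemma first_ascent_cons2 a b w :
  first_ascent [:: a, b & w] =
  if b < a then (first_ascent (b :: w)).+1 else 1.
Proof.
have ascent_1 : ascent [:: a, b & w] 1 = ~~ (b < a) by [].
case: ifP ascent_1 => _ ascent_1; last by rewrite /first_ascent /= ascent_1.
have ascent_shift : [seq i <- iota 2 (size w).+1 | ascent [:: a, b & w] i] =
    [seq i.+1 | i <- iota 1 (size w).+1 & ascent (b :: w) i].
  rewrite (iotaDl 1 1) filter_map; congr map.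
  by apply: eq_in_filter => -[|i]; rewrite mem_iota.
have last_ascent :
    size (b :: w) \in [seq i <- iota 1 (size w).+1 | ascent (b :: w) i].
  by rewrite mem_filter mem_iota /ascent /descent /=; lia.
rewrite /first_ascent -[size [:: a, b & w]]/(1 + (size w).+1) iotaD filter_cat.
rewrite ascent_shift [filter _ (iota 1 1)]/= ascent_1 cat0s.
by case: [seq i <- _ | _] last_ascent.
Qed.

Lemma first_ascent_cons_max m w :
  all (gtn m) w -> first_ascent (m :: w) = (first_ascent w).+1.
Proof.
by case: w => // b w /andP[/= b_lt _]; rewrite first_ascent_cons2 b_lt.
Qed.

Lemma perm_iota_uniq n w : perm_eq w (iota 1 n) -> uniq w.
Proof. by move/perm_uniq->; apply: iota_uniq. Qed.

Lemma perm_iota_mem n w x : perm_eq w (iota 1 n) -> (x \in w) = (0 < x <= n).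
Proof. by move/perm_mem->; rewrite mem_iota add1n ltnS. Qed.

Lemma perm_iota_lt n w : perm_eq w (iota 1 n) -> all (gtn n.+1) w.
Proof.
by move=> pw; apply/allP => x; rewrite (perm_iota_mem _ pw) => /andP[].
Qed.

Lemma perm_iota_insert_max n p q :
  perm_eq (p ++ n.+1 :: q) (iota 1 n.+1) = perm_eq (p ++ q) (iota 1 n).
Proof.
have -> : iota 1 n.+1 = iota 1 n ++ [:: n.+1].
  by rewrite -[in LHS](addn1 n) iotaD add1n.
by rewrite -cat_rcons -cats1 perm_catAC perm_cat2r.
Qed.

Lemma perm_iota_cons_min n w :
  perm_eq (cons_min w) (iota 1 n.+1) = perm_eq w (iota 1 n).
Proof.
rewrite /= (iotaDl 1) perm_cons; apply/idP/idP; last exact: perm_map.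
by apply: perm_map_inj => x y [].
Qed.

Lemma perm_iota_split_max n w : perm_eq w (iota 1 n.+1) ->
  exists p q, w = p ++ n.+1 :: q /\ perm_eq (p ++ q) (iota 1 n).
Proof.
move=> pw; have nw : n.+1 \in w by rewrite (perm_iota_mem _ pw) /=.
by case/splitPr: nw pw => p q; rewrite perm_iota_insert_max; exists p, q.
Qed.

Definition pattern_free (Pi : seq (seq nat)) (w : seq nat) : bool :=
  all (fun s => ~~ contains w s) Pi.

Definition avoiders (Pi : seq (seq nat)) (n : nat) : seq (seq nat) :=
  [seq w <- permutations (iota 1 n) | pattern_free Pi w].

Definition max_first_avoiders (Pi : seq (seq nat)) (n : nat) : seq (seq nat) :=
  [seq w <- avoiders Pi n | head 0 w == n].

Definition max_later_avoiders (Pi : seq (seq nat)) (n : nat) : seq (seq nat) :=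
  [seq w <- avoiders Pi n | head 0 w != n].

Lemma mem_avoiders Pi n w :
  (w \in avoiders Pi n) = pattern_free Pi w && perm_eq w (iota 1 n).
Proof. by rewrite mem_filter mem_permutations. Qed.

Lemma mem_avoiders2 s t n w :
  (w \in avoiders [:: s; t] n) =
  [&& ~~ contains w s, ~~ contains w t & perm_eq w (iota 1 n)].
Proof. by rewrite mem_avoiders /pattern_free [all _ _]/= andbT andbA. Qed.

Lemma avoiders_uniq Pi n : uniq (avoiders Pi n).
Proof. exact/filter_uniq/permutations_uniq. Qed.

Definition even_first_ascent (w : seq nat) : bool := ~~ odd (first_ascent w).

Lemma perm_one_line n (p : 'S_n) : perm_eq (one_line p) (iota 1 n).
Proof.
apply: uniq_perm; rewrite ?iota_uniq //.
  by rewrite map_inj_uniq ?enum_uniq // => i j [] /val_inj; apply: perm_inj.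
move=> x; rewrite mem_iota add1n ltnS.
apply/mapP/andP => [[i _ ->] | [x_gt0 x_le]]; first by rewrite ltn_ord.
case: x x_gt0 x_le => // x _ x_lt.
by exists ((p^-1)%g (Ordinal x_lt)); rewrite ?mem_enum // permKV.
Qed.

Lemma one_line_inj n : injective (@one_line n).
Proof.
move=> p q /eq_in_map pq; apply/permP => i; apply: val_inj.
by apply: succn_inj; apply: pq; rewrite mem_enum.
Qed.

Lemma perm_one_lines n :
  perm_eq [seq one_line p | p : 'S_n] (permutations (iota 1 n)).
Proof.
have one_lines_uniq : uniq [seq one_line p | p : 'S_n].
  by rewrite map_inj_uniq ?enum_uniq //; apply: one_line_inj.
apply: uniq_perm => //; first exact: permutations_uniq.
have [] // := uniq_min_size one_lines_uniq (s2 := permutations (iota 1 n)).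
- by move=> _ /mapP[p _ ->]; rewrite mem_permutations perm_one_line.
- rewrite size_map -cardE card_Sn size_permutations ?iota_uniq //.
  by rewrite size_iota.
Qed.

Lemma num_desarrE Pi n :
  num_desarr n Pi = count even_first_ascent (avoiders Pi n).
Proof.
rewrite /num_desarr count_filter -(seq.permP (perm_one_lines n)) count_map.
by rewrite cardsE cardE size_filter -enumT; apply: eq_count => p.
Qed.

Lemma jacobsthal_addS n : jacobsthal n + jacobsthal n.+1 = 2 ^ n.
Proof.
elim: n => // n; rewrite expnS => <-.
by rewrite [jacobsthal n.+2]/= -/(jacobsthal n.+1); lia.
Qed.

Section AvoidersCount.

Variable Pi : seq (seq nat).
Hypothesis Pi_head : {in Pi, forall s, head_below_max s}.

Lemma avoiders_cons_max n w :
  (n.+1 :: w \in avoiders Pi n.+1) = (w \in avoiders Pi n).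
Proof.
rewrite !mem_avoiders (perm_iota_insert_max n [::]); apply: andb_id2r => pw.
by apply: eq_in_all => s /Pi_head sP; rewrite contains_cons_max ?perm_iota_lt.
Qed.

Lemma perm_max_first_avoiders n :
  perm_eq (max_first_avoiders Pi n.+1) [seq n.+1 :: w | w <- avoiders Pi n].
Proof.
apply: uniq_perm; first exact/filter_uniq/avoiders_uniq.
  by rewrite map_inj_uniq ?avoiders_uniq // => u v [].
move=> w; rewrite mem_filter; apply/andP/mapP => [[] | [u u_av ->]].
  case: w => //= a u /eqP ->; rewrite avoiders_cons_max => u_av.
  by exists u.
by rewrite avoiders_cons_max /= eqxx.
Qed.

Lemma size_avoidersS n :
  size (avoiders Pi n.+1) =
  size (avoiders Pi n) + size (max_later_avoiders Pi n.+1).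
Proof.
rewrite -(count_predC (fun w => head 0 w == n.+1)) -!size_filter.
by congr (_ + _); rewrite (perm_size (perm_max_first_avoiders n)) size_map.
Qed.

Lemma avoiders1 : avoiders Pi 1 = [:: [:: 1]].
Proof.
rewrite /avoiders /= (_ : pattern_free Pi _) //.
apply/allP => s /Pi_head s_head.
apply: contraL s_head => /contains_size.
by case: s => [|a [|b s]] //= _; rewrite /head_below_max /= ltnn.
Qed.

Hypothesis size_max_later :
  forall n, size (max_later_avoiders Pi n.+2) = size (avoiders Pi n.+1).

Lemma size_avoiders_expn n : size (avoiders Pi n.+1) = 2 ^ n.
Proof.
elim: n => [|n IHn]; first by rewrite avoiders1.
by rewrite size_avoidersS size_max_later IHn addnn -mul2n expnS.
Qed.

Hypothesis Pi213 : [:: 2; 1; 3] \in Pi.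

Lemma even_first_ascent_head_max n w : w \in avoiders Pi n.+1 ->
  even_first_ascent w -> head 0 w = n.+1.
Proof.
rewrite mem_avoiders => /andP[/allP/(_ _ Pi213) w213].
case/perm_iota_split_max => p [q [wE pq]]; move: w213; rewrite {}wE.
rewrite avoids213_insert_max ?perm_iota_lt // => /andP[_].
have p_lt := perm_iota_lt pq.
case: p p_lt {pq} => [|a [|b p]] //= /andP[a_lt _] p_incr.
- by rewrite /even_first_ascent first_ascent_cons2 ltnNge ltnW.
- move: p_incr => /andP[/andP[ab _] _].
  by rewrite /even_first_ascent first_ascent_cons2 ltnNge ab.
Qed.

Lemma count_even_first_ascentS n :
  count even_first_ascent (avoiders Pi n.+1)
    + count even_first_ascent (avoiders Pi n) = size (avoiders Pi n).
Proof.
rewrite -(count_predC even_first_ascent) addnC; congr (_ + _).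
have -> : count even_first_ascent (avoiders Pi n.+1) =
    count even_first_ascent (max_first_avoiders Pi n.+1).
  rewrite [RHS]count_filter; apply: eq_in_count => w w_av /=.
  have [w_even | //] := boolP (even_first_ascent w).
  by rewrite (even_first_ascent_head_max w_av) ?eqxx.
rewrite (seq.permP (perm_max_first_avoiders n)) count_map.
apply: eq_in_count => w; rewrite mem_avoiders => /andP[_ /perm_iota_lt w_lt].
by rewrite /= /even_first_ascent first_ascent_cons_max.
Qed.

Lemma count_even_first_ascent_jacobsthal n :
  count even_first_ascent (avoiders Pi n.+1) = jacobsthal n.
Proof.
elim: n => [|n IHn]; first by rewrite avoiders1.
have := count_even_first_ascentS n.+1.
by rewrite IHn size_avoiders_expn -jacobsthal_addS addnC => /addnI.
Qed.

End AvoidersCount.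

Section ActiveSite.

Variables (Pi : seq (seq nat)) (n : nat) (site : seq nat -> nat).
Hypothesis site_range : {in avoiders Pi n, forall w, 0 < site w <= size w}.
Hypothesis siteP : forall p q, p != [::] -> perm_eq (p ++ q) (iota 1 n) ->
  (p ++ n.+1 :: q \in avoiders Pi n.+1) =
  (p ++ q \in avoiders Pi n) && (size p == site (p ++ q)).

Lemma avoiders_insert_site w : w \in avoiders Pi n ->
  insert_at (site w) n.+1 w \in max_later_avoiders Pi n.+1.
Proof.
move=> w_av; have /andP[site_gt0 site_le] := site_range w_av.
have := w_av; rewrite mem_avoiders => /andP[_ pw].
have size_take_site : size (take (site w) w) = site w by rewrite size_takel.
have take_neq0 : take (site w) w != [::].
  by rewrite -size_eq0 size_take_site -lt0n.
rewrite mem_filter andbC siteP ?cat_take_drop // w_av size_take_site eqxx.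
rewrite /insert_at.
have := perm_iota_lt pw; rewrite -{1}[w](cat_take_drop (site w)).
by case: take take_neq0 => //= a p _ /andP[a_lt _]; rewrite neq_ltn a_lt.
Qed.

Lemma size_max_later_site :
  size (max_later_avoiders Pi n.+1) = size (avoiders Pi n).
Proof.
rewrite -[RHS](size_map (fun w => insert_at (site w) n.+1 w)).
apply/perm_size/uniq_perm; first exact/filter_uniq/avoiders_uniq.
  rewrite map_inj_in_uniq ?avoiders_uniq //.
  apply: (can_in_inj (g := filter (predC1 n.+1))) => w.
  rewrite mem_avoiders => /andP[_ pw]; apply: filter_insert_at.
  by rewrite (perm_iota_mem _ pw) ltnn andbF.
move=> w; apply/idP/mapP => [ | [u u_av ->]]; last exact: avoiders_insert_site.
rewrite mem_filter => /andP[w_head w_av].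
have := w_av; rewrite mem_avoiders => /andP[_ /perm_iota_split_max].
case=> p [q [wE pq]]; move: w_head w_av; rewrite {}wE => w_head.
have p_neq0 : p != [::] by apply: contraNneq w_head => ->.
rewrite siteP // => /andP[u_av /eqP site_eq].
by exists (p ++ q); rewrite // -site_eq insert_at_cat.
Qed.

End ActiveSite.

Lemma avoiders213_123_insert_max n p q :
  p != [::] -> perm_eq (p ++ q) (iota 1 n) ->
  (p ++ n.+1 :: q \in avoiders [:: [:: 2; 1; 3]; [:: 1; 2; 3]] n.+1) =
  (p ++ q \in avoiders [:: [:: 2; 1; 3]; [:: 1; 2; 3]] n) && (size p == 1).
Proof.
move=> p_neq0 pq; rewrite !mem_avoiders2 perm_iota_insert_max pq !andbT.
rewrite avoids213_insert_max ?avoids123_insert_max ?perm_iota_lt //.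
rewrite andbACA; congr andb; have := perm_iota_uniq pq.
case: p p_neq0 {pq} => [|a [|b p]] //= _ /andP[/norP[/negbTE ab _] _].
by move: ab; lia.
Qed.

Lemma size_max_later213_123 n :
  size (max_later_avoiders [:: [:: 2; 1; 3]; [:: 1; 2; 3]] n.+2) =
  size (avoiders [:: [:: 2; 1; 3]; [:: 1; 2; 3]] n.+1).
Proof.
apply: (size_max_later_site (site := fun=> 1)) => [w | ].
  by rewrite mem_avoiders => /andP[_ /perm_size ->]; rewrite size_iota.
exact: avoiders213_123_insert_max.
Qed.

Lemma avoiders213_132_insert_max n p q :
  p != [::] -> perm_eq (p ++ q) (iota 1 n.+1) ->
  (p ++ n.+2 :: q \in avoiders [:: [:: 2; 1; 3]; [:: 1; 3; 2]] n.+2) =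
  (p ++ q \in avoiders [:: [:: 2; 1; 3]; [:: 1; 3; 2]] n.+1)
  && (size p == (index n.+1 (p ++ q)).+1).
Proof.
move=> + pq; rewrite !mem_avoiders2 perm_iota_insert_max pq !andbT.
rewrite avoids213_insert_max ?avoids132_insert_max ?perm_iota_lt //.
case/lastP: p pq => // p m; rewrite cat_rcons size_rcons eqSS => pmq _.
rewrite index_pivot ?(perm_iota_uniq pmq) // andbACA; apply: andb_id2l.
case/andP=> av213 av132; rewrite pairwise_rcons -cats1 allrel_catl allrel1l.
have [m_eq | m_neq] := eqVneq n.+1 m.
  move: pmq av213 av132; rewrite -m_eq perm_iota_insert_max.
  move=> /perm_iota_lt pq_lt; rewrite avoids213_insert_max //.
  rewrite avoids132_insert_max // => /andP[_ ->] /andP[_ ->].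
  move: pq_lt; rewrite all_cat => /andP[p_lt q_lt]; rewrite andbT.
  by apply/andP; split; [apply: sub_all p_lt | apply: sub_all q_lt] => x /ltnW.
apply/negP => /andP[/andP[/allP p_le _] /andP[_ /allP q_le]].
have m_lt : m < n.+1.
  rewrite ltn_neqAle eq_sym m_neq /=.
  have : m \in p ++ m :: q by rewrite mem_cat mem_head orbT.
  by rewrite (perm_iota_mem _ pmq) => /andP[].
have : n.+1 \in p ++ m :: q by rewrite (perm_iota_mem _ pmq) /=.
by rewrite mem_cat inE (negbTE m_neq) => /orP[/p_le | /q_le] /=; lia.
Qed.

Lemma size_max_later213_132 n :
  size (max_later_avoiders [:: [:: 2; 1; 3]; [:: 1; 3; 2]] n.+2) =
  size (avoiders [:: [:: 2; 1; 3]; [:: 1; 3; 2]] n.+1).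
Proof.
apply: (size_max_later_site (site := fun w => (index n.+1 w).+1)) => [w | ].
  by rewrite mem_avoiders index_mem => /andP[_ /perm_iota_mem->]; rewrite /=.
exact: avoiders213_132_insert_max.
Qed.

Lemma avoiders213_231_cons_min n w :
  (cons_min w \in avoiders [:: [:: 2; 1; 3]; [:: 2; 3; 1]] n.+1) =
  (w \in avoiders [:: [:: 2; 1; 3]; [:: 2; 3; 1]] n).
Proof.
rewrite !mem_avoiders2 perm_iota_cons_min.
by rewrite avoids213_cons_min avoids231_cons_min.
Qed.

Lemma avoiders213_231_head n a w :
  (a :: w \in avoiders [:: [:: 2; 1; 3]; [:: 2; 3; 1]] n.+1) ->
  a = 1 \/ a = n.+1.
Proof.
rewrite mem_avoiders2 => /and3P[av213 av231 paw].
have /andP[a_notin _] := perm_iota_uniq paw.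
have mem_aw x := perm_iota_mem x paw.
have a_range : 0 < a <= n.+1 by rewrite -mem_aw mem_head.
case/orP: (avoids213_231_head_extremal a_notin av213 av231) => /allP a_extr.
- right; have : n.+1 \in a :: w by rewrite mem_aw /=.
  by rewrite inE => /predU1P[-> // | /a_extr /=]; lia.
- left; have : 1 \in a :: w by rewrite mem_aw.
  by rewrite inE => /predU1P[-> // | /a_extr /=]; lia.
Qed.

Lemma size_max_later213_231 n :
  size (max_later_avoiders [:: [:: 2; 1; 3]; [:: 2; 3; 1]] n.+2) =
  size (avoiders [:: [:: 2; 1; 3]; [:: 2; 3; 1]] n.+1).
Proof.
rewrite -[RHS](size_map cons_min).
apply/perm_size/uniq_perm; first exact/filter_uniq/avoiders_uniq.
  by rewrite map_inj_uniq ?avoiders_uniq // => u v [] /inj_map; apply=> x y [].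
move=> w; rewrite mem_filter; apply/andP/mapP => [[w_head w_av] | [u u_av ->]].
  case: w w_head w_av => [_ | a t a_neq at_av].
    by rewrite mem_avoiders => /andP[].
  have [a_min | a_max] := avoiders213_231_head at_av; last first.
    by rewrite a_max eqxx in a_neq.
  have at_eq : a :: t = cons_min (map predn t).
    rewrite a_min /cons_min -map_comp map_id_in // => x xt /=; apply: prednK.
    move: at_av; rewrite mem_avoiders => /andP[_ /perm_iota_mem pat].
    by have := pat x; rewrite inE xt orbT => /esym/andP[].
  exists (map predn t) => //.
  by rewrite -avoiders213_231_cons_min -at_eq.
by rewrite avoiders213_231_cons_min.
Qed.

Theorem theorem3p17 (n : nat) (sigma : seq nat) (hn : 1 <= n)
  (hsigma : sigma \in [:: [:: 1; 2; 3]; [:: 1; 3; 2]; [:: 2; 3; 1]]) :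
  num_desarr n [:: [:: 2; 1; 3]; sigma] = jacobsthal n.-1.
Proof.
case: n hn => // n _; rewrite num_desarrE.
apply: count_even_first_ascent_jacobsthal; last by rewrite mem_head.
- by apply/allP => /=; move: hsigma; rewrite !inE => /or3P[] /eqP ->.
- move=> {}n; move: hsigma; rewrite !inE => /or3P[] /eqP ->.
  + exact: size_max_later213_123.
  + exact: size_max_later213_132.
  + exact: size_max_later213_231.
Qed.
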